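(* For any positive braid word $\beta$ there exists a subset of its crossings which is at the same time the set of switches of a ruling of the front diagram $f_\beta$ and an augmentation of the Lagrangian diagram $\gamma_\beta$ of the Legendrian closure of $\beta$.
   Context: Positive braid words. A positive braid word on $q$ strands is a word $\beta=\sigma_{i_1}\sigma_{i_2}\cdots\sigma_{i_w}$ in the standard generators $\sigma_1,\ldots,\sigma_{q-1}$ of the braid group. It is drawn horizontally, read from left to right; the left and right endpoints of the strands are labeled $1,\ldots,q$ from top to bottom, $\sigma_i$ is a crossing between levels $i$ and $i+1$, and the crossings are labeled $b_1,\ldots,b_w$ from left to right. Diagrams. The Legendrian closure $L_\beta$ of $\beta$ (in standard contact $\mathbf{R}^3$) has a front diagram $f_\beta$ obtained by closing up $\beta$ by $q$ nested strands above it: the $i$th closing strand is joined to the left endpoint $i$ of $\beta$ by a left cusp and to the right endpoint $i$ by a right cusp, the closing strands lie above $\beta$, the $i$th one lies below the $j$th one when $i<j$, and $f_\beta$ has no crossings other than those of $\beta$. $\gamma_\beta$ is the Lagrangian diagram obtained from $f_\beta$ by resolution; its crossings are $b_1,\ldots,b_w$ together with $a_1,\ldots,a_q$ (one for each right cusp). Rulings. A ruling of a front diagram is a partial splicing of the diagram where certain crossings, called switches, are each replaced by a pair of arcs (one upper arc, joining the two upper ends at the crossing, and one lower arc, joining the two lower ends) so that the diagram becomes a (not necessarily disjoint) union of eyes. An eye is a pair of arcs connecting the same two cusps that contain no other cusps and that otherwise do not meet, not even at switches. It is required that in the vertical slice of the diagram through each switch, the two eyes that meet at the switch (each of which meets the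 slice in the two endpoints of a vertical interval) either lie one above the other or are nested one inside the other (they are not interleaved). For $f_\beta$ this means: after splicing $\beta$ at the switches, the path starting at each left endpoint $i$ and going from left to right ends at the right endpoint $i$ (call it $s_i$), and at each switch the upper arc belongs to $s_i$ and the lower arc to $s_j$ with $i<j$. (All crossings of $f_\beta$ have index $0$, so ungraded, $2$-graded and $\mathbf{Z}$-graded rulings of $f_\beta$ coincide.) Path matrix. $B_\beta=[B_{i,j}]$ is the $q\times q$ matrix in which $B_{i,j}$ is the sum of the following products: for each path composed of parts of the strands of $\beta$ that connects the left endpoint $i$ to the right endpoint $j$ (travelling from left to right) so that it only turns around quadrants facing up, take the product, from left to right, of the labels of the crossings at which it turns. Equivalently, $B_\beta=B_{\sigma_{i_1}}(b_1)\cdots B_{\sigma_{i_w}}(b_w)$, where $B_{\sigma_i}(b)$ is the $q\times q$ identity matrix with the block in rows and columns $i,i+1$ replaced by $\begin{bmatrix} b&1\\1&0\end{bmatrix}$ (for the empty word, $B_\beta$ is the identity). The DGA. The Chekanov–Eliashberg DGA $\mathscr{A}$ of $\gamma_\beta$ is the free non-commutative unital algebra over $\mathbf{Z}_2$ on the generators $b_1,\ldots,b_w,a_1,\ldots,a_q$, with grading (index) $|b_k|=0$, $|a_n|=1$, and differential $\partial$ determined by the Leibniz rule, linearity, and $$\partial(b_k)=0,\qquad \partial(a_n)=1+C_{n,n},\qquad C_{n,n}=\sum_{(i_1,\ldots,i_c)\in D_n}B_{n,i_1}B_{i_1,i_2}\cdots B_{i_{c-1},i_c}B_{i_c,n}.$$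 Here a finite sequence of positive integers is called admissible if for all $s\ge1$, between any two appearances of $s$ there is a number greater than $s$ appearing between them, and $D_n$ is the set of all admissible sequences composed of the numbers $1,\ldots,n-1$ (including the empty sequence, which contributes the term $B_{n,n}$). Augmentations. An augmentation of $\gamma_\beta$ is a subset $X$ of its crossings such that each element of $X$ has index $0$ and such that, for each generator $a$ of index $1$, $\varepsilon_X(\partial(a))=0$, where $\varepsilon_X\colon\mathscr{A}\to\mathbf{Z}_2$ is the algebra homomorphism sending elements of $X$ to $1$ and the other generators to $0$ (equivalently, the number of admissible discs with positive corner $a$ and all negative corners in $X$ is even). *)

(* Defs.v *)
From HB Require Import structures.
From mathcomp Require Import all_boot all_order all_algebra.
From mathcomp Require Import finmap.
From mathcomp Require Import monalg.

Set Implicit Arguments.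
Unset Strict Implicit.
Unset Printing Implicit Defensive.

Import GRing.Theory.
Local Open Scope ring_scope.

(* Everything is indexed from 0: the generators sigma_1, ..., sigma_(q-1) are  *)
(* the elements of 'I_q.-1, the levels 1, ..., q are those of 'I_q, and the    *)
(* crossings b_1, ..., b_w are those of 'I_w.                                  *)
Definition braid_word (q w : nat) := w.-tuple 'I_q.-1.

(* A generic front is cut into elementary pieces, read from left to right.     *)
(* Strands in a vertical slice are numbered 0, 1, ... from top to bottom:      *)
(* LeftCusp k creates the strands k and k+1, RightCusp k joins the strands k   *)
(* and k+1, and Crossing x k is a crossing, labelled x, of these two strands.  *)
Inductive front_event (T : Type) :=
| LeftCusp of nat
| Crossing of T & nat
| RightCusp of nat.

Arguments LeftCusp {T} k.
Arguments Crossing {T} x k.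
Arguments RightCusp {T} k.

Definition front (T : Type) := seq (front_event T).

(* A slice of the spliced diagram is listed from top to bottom, each strand    *)
(* being replaced by the name of its eye; u and v are the eyes to compare.     *)
Definition interleaved (slice : seq nat) (u v : nat) : bool :=
  [seq z <- slice | (z == u) || (z == v)]
    \in [:: [:: u; v; u; v]; [:: v; u; v; u]].

(* Follows the diagram spliced at X, starting from the given slice; an eye is  *)
(* named after its left cusp, and n is the number of left cusps met so far.    *)
(* At a switch the slice is unchanged (upper ends are joined together, and so  *)
(* are lower ends). The arcs of an eye never meet, hence u != v at every       *)
(* crossing, and they end at the same right cusp, hence u == v there.          *)
Fixpoint ruling_from (T : finType) (X : {set T}) (n : nat) (slice : seq nat)
    (f : front T) : bool :=
  match f with
  | [::] => slice == [::]
  | LeftCusp k :: f' =>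
      ruling_from X n.+1 (take k slice ++ [:: n, n & drop k slice]) f'
  | Crossing x k :: f' =>
      if drop k slice is [:: u, v & below] then
        (u != v) &&
        (if x \in X then ~~ interleaved slice u v && ruling_from X n slice f'
         else ruling_from X n (take k slice ++ [:: v, u & below]) f')
      else false
  | RightCusp k :: f' =>
      if drop k slice is [:: u, v & below] then
        (u == v) && ruling_from X n (take k slice ++ below) f'
      else false
  end.

Definition ruling_switches (T : finType) (f : front T) (X : {set T}) : bool :=
  ruling_from X 0 [::] f.

(* The outermost (last) closing strand is created first and closed last; along *)
(* beta the closing strands are the upper q ones, so level i of beta is strand *)
(* q + i.                                                                      *)
Definition front_closure (q w : nat) (beta : braid_word q w) : front 'I_w :=
  [seq LeftCusp i | i <- iota 0 q]
  ++ [seq Crossing r (q + tnth beta r)%N | r <- enum 'I_w]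
  ++ [seq RightCusp i | i <- rev (iota 0 q)].

(* Crossings of the Lagrangian diagram: inl r is b_r and inr n is a_n.         *)
Definition crossing (q w : nat) : finType := ('I_w + 'I_q)%type.

Definition grading (q w : nat) (c : crossing q w) : nat :=
  match c with inl _ => 0 | inr _ => 1 end.

(* The free unital algebra over Z_2 on the crossings.                          *)
Definition dga (q w : nat) := {malg 'F_2[{fmonom (crossing q w)}]}.

Definition gen (q w : nat) (c : crossing q w) : dga q w := << fmu c >>.

Section PathMatrix.
Variables (q w : nat).
Local Notation A := (dga q w).

Definition Bsigma (i : 'I_q.-1) (b : A) : 'M[A]_q :=
  \matrix_(j, k)
    if (j == i :> nat) && (k == i :> nat) then b
    else if (j == i :> nat) && (k == i.+1 :> nat) then 1
    else if (j == i.+1 :> nat) && (k == i :> nat) then 1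
    else if (j == i.+1 :> nat) && (k == i.+1 :> nat) then 0
    else (j == k)%:R.

Definition path_matrix (beta : braid_word q w) : 'M[A]_q :=
  \big[mulmx/1%:M]_(r < w) Bsigma (tnth beta r) (gen (inl r)).

End PathMatrix.

Definition admissible (q : nat) (s : seq 'I_q) : bool :=
  [forall u : 'I_(size s), forall v : 'I_(size s),
    (u < v)%N && (tnth (in_tuple s) u == tnth (in_tuple s) v) ==>
    [exists t : 'I_(size s),
      (u < t < v)%N && (tnth (in_tuple s) u < tnth (in_tuple s) t)%N]].

(* D q n is the set of all admissible sequences of numbers less than n: by     *)
(* mem_D and uniq_D below, bounding the length loses none of them and each one *)
(* is listed once.                                                             *)
Definition D (q n : nat) : seq (seq 'I_q) :=
  [seq s <- flatten [seq [seq val t | t : l.-tuple 'I_q] | l <- iota 0 (2 ^ n)]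
     | admissible s && all (fun i : 'I_q => (i < n)%N) s].

Lemma admissibleP (q : nat) (s : seq 'I_q) :
  reflect (forall (x0 : 'I_q) (u v : nat), (u < v < size s)%N ->
             nth x0 s u = nth x0 s v ->
             exists2 t, (u < t < v)%N & (nth x0 s u < nth x0 s t)%N)
          (admissible s).
Proof.
apply: (iffP idP) => [/forallP H x0 u v /andP[uv vs] e | H].
  have us := ltn_trans uv vs.
  have /forallP/(_ (Ordinal vs))/implyP := H (Ordinal us).
  rewrite !(tnth_nth x0) /= uv e eqxx => /(_ isT)/existsP[t /andP[ut lt]].
  by exists (val t) => //; move: lt; rewrite !(tnth_nth x0).
apply/forallP => u; apply/forallP => v; apply/implyP => /andP[uv /eqP e].
have x0 := tnth (in_tuple s) u.
have [||t /andP[ut tv]] := H x0 u v; first by rewrite uv ltn_ord.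
  by rewrite -!(tnth_nth x0 (in_tuple s)).
move=> lt; apply/existsP; exists (Ordinal (ltn_trans tv (ltn_ord v))).
by rewrite !(tnth_nth x0) /= ut tv.
Qed.

Lemma admissible_cat (q : nat) (s1 s2 s3 : seq 'I_q) :
  admissible (s1 ++ s2 ++ s3) -> admissible s2.
Proof.
move=> /admissibleP H; apply/admissibleP => x0 u v /andP[uv vs] e.
have E p : (p < size s2)%N ->
    nth x0 (s1 ++ s2 ++ s3) (size s1 + p) = nth x0 s2 p.
  by move=> ps; rewrite nth_cat ltnNge leq_addr /= addKn nth_cat ps.
have us := ltn_trans uv vs.
have [||t /andP[ut tv]] := H x0 (size s1 + u)%N (size s1 + v)%N.
- by rewrite !size_cat !ltn_add2l uv /= ltn_addr.
- by rewrite !E.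
have lt : (size s1 <= t)%N by apply: leq_trans (ltnW ut); rewrite leq_addr.
move: ut tv; rewrite -(subnKC lt) !ltn_add2l => ut tv.
by rewrite !E ?(ltn_trans tv) // => ?; exists (t - size s1)%N; rewrite ?ut.
Qed.

Lemma size_admissible (q n : nat) (s : seq 'I_q) :
  admissible s -> all (fun i : 'I_q => (i < n)%N) s -> (size s < 2 ^ n)%N.
Proof.
elim: n s => [|n IHn] s As; first by case: s As.
move=> /allP sn1.
have [/hasP[x xs /eqP xn]|/hasPn sn] :=
  boolP (has (fun i : 'I_q => i == n :> nat) s); last first.
  have lt : (size s < 2 ^ n)%N.
    apply: IHn => //; apply/allP => i is_.
    by have := sn1 i is_; rewrite ltnS leq_eqVlt (negPf (sn i is_)).
  by rewrite (leq_trans lt) // leq_exp2l.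
have once u v : (u < v < size s)%N -> nth x s u = x -> nth x s v = x -> false.
  move=> uvs eu ev; have /andP[uv vs] := uvs.
  have [|t /andP[ut tv]] := admissibleP _ As x u v uvs; first by rewrite eu ev.
  have := sn1 _ (mem_nth x (ltn_trans tv vs)).
  by rewrite eu xn ltnS leqNgt => /negPf->.
case/splitPr: xs As sn1 once => s1 s2 As sn1 once.
have A1 : admissible s1 by apply: (@admissible_cat q [::] s1 (x :: s2)).
have A2 : admissible s2.
  by apply: (@admissible_cat q (rcons s1 x) s2 [::]); rewrite cats0 cat_rcons.
have nx (i : 'I_q) : i != x -> (i < n.+1)%N -> (i < n)%N.
  by rewrite ltnS leq_eqVlt => ix /predU1P[/= e|//]; rewrite -val_eqE /= e xn eqxx in ix.
have lt1 : (size s1 < 2 ^ n)%N.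
  apply: IHn A1 _; apply/allP => i is1; apply: nx; last first.
    by apply: sn1; rewrite mem_cat is1.
  apply/eqP => e; subst i; have := once (seq.index x s1) (size s1).
  rewrite size_cat /= -[X in (_ < X < _)%N]addn0 ltn_add2l addn0 index_mem is1 /=.
  rewrite !nth_cat index_mem is1 nth_index // ltnn subnn /=.
  by move=> /(_ isT erefl erefl).
have lt2 : (size s2 < 2 ^ n)%N.
  apply: IHn A2 _; apply/allP => i is2; apply: nx; last first.
    by apply: sn1; rewrite mem_cat in_cons is2 !orbT.
  apply/eqP => e; subst i.
  have := once (size s1) (size s1 + (seq.index x s2).+1)%N.
  rewrite size_cat /= -[X in (X < _ < _)%N]addn0 !ltn_add2l /= ltnS index_mem is2.
  rewrite !nth_cat ltnn subnn ltnNge leq_addr /= addKn /= nth_index //.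
  by move=> /(_ isT erefl erefl).
by rewrite size_cat /= expnS mul2n -addnn -addSn leq_add.
Qed.

Lemma mem_D (q n : nat) (s : seq 'I_q) :
  (s \in D q n) = admissible s && all (fun i : 'I_q => (i < n)%N) s.
Proof.
rewrite mem_filter; apply: andb_idr => /andP[As sn].
apply/flatten_mapP; exists (size s).
  by rewrite mem_iota size_admissible.
by apply/imageP; exists (in_tuple s).
Qed.

Lemma uniq_D (q n : nat) : uniq (D q n).
Proof.
apply/filter_uniq; elim: (2 ^ n)%N => [//|m IHm].
rewrite -addn1 iotaD map_cat flatten_cat cat_uniq IHm /= cats0 add0n.
rewrite map_inj_uniq ?enum_uniq ?andbT //; last exact: val_inj.
apply/hasPn => _ /imageP[t _ ->]; apply/flatten_mapP => -[l].
rewrite mem_iota add0n => lm /imageP[t' _ /(congr1 size)].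
by rewrite !size_tuple => e; rewrite e ltnn andbF in lm.
Qed.

Section Dga.
Variables (q w : nat) (beta : braid_word q w).
Local Notation A := (dga q w).

(* B_{n,i_1} B_{i_1,i_2} ... B_{i_c,m} for s = (i_1, ..., i_c). *)
Fixpoint chain (B : 'M[A]_q) (n : 'I_q) (s : seq 'I_q) (m : 'I_q) : A :=
  if s is i :: s' then B n i * chain B i s' m else B n m.

Definition C (n : 'I_q) : A :=
  \sum_(s <- D q n) chain (path_matrix beta) n s n.

Definition diff_gen (c : crossing q w) : A :=
  match c with inl _ => 0 | inr n => 1 + C n end.

Fixpoint diff_word (s : seq (crossing q w)) : A :=
  if s is c :: s' then
    diff_gen c * (\prod_(c' <- s') gen c') + gen c * diff_word s'
  else 0.

Definition diff (p : A) : A :=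
  mmap (@malgC _ _) (fun s : {fmonom crossing q w} => diff_word s) p.

Lemma gen_word (s : {fmonom crossing q w}) : \prod_(c <- s) gen c = << s >> :> A.
Proof.
case: s => s; elim: s => [|c s IHs] /=.
  by rewrite big_nil -[1]/(<< _ >>) /mone /one /= fmoneE.
rewrite big_cons IHs malgM_def fgmulUU mul1r; congr << _ >>.
by apply: val_inj; rewrite /= fmM fmU.
Qed.

Lemma diffU (x : 'F_2) (s : {fmonom crossing q w}) :
  diff << x *g s >> = x *: diff_word s.
Proof. by rewrite /diff mmapU mul_malgC. Qed.

Lemma diff_genE (c : crossing q w) : diff (gen c) = diff_gen c.
Proof. by rewrite /gen diffU scale1r fmU /= big_nil mulr1 mulr0 addr0. Qed.

Lemma diffD : {morph diff : x y / x + y}.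
Proof. exact: mmapD. Qed.

Lemma diffM (x y : A) : diff (x * y) = diff x * y + x * diff y.
Proof.
have dist (R : pzRingType) (a b c d e f : R) :
  a * (b * c) + d * (e * c + b * f) = (a * b + d * e) * c + d * b * f.
  by rewrite mulrDl mulrDr !mulrA addrA.
have word_cat (s t : seq (crossing q w)) : diff_word (s ++ t) =
    diff_word s * (\prod_(c <- t) gen c) + (\prod_(c <- s) gen c) * diff_word t.
  elim: s => [|c s IHs] /=; first by rewrite mul0r add0r big_nil mul1r.
  by rewrite IHs big_cat big_cons; apply: dist.
have diff0 : diff 0 = 0 by exact: mmap0.
have sums (R : pzRingType) (d : R -> R) (I J : Type) (r : seq I) (r' : seq J)
    (F : I -> R) (G : J -> R) : d 0 = 0 -> {morph d : u v / u + v} ->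
    (forall i j, d (F i * G j) = d (F i) * G j + F i * d (G j)) ->
    d ((\sum_(i <- r) F i) * (\sum_(j <- r') G j)) =
    d (\sum_(i <- r) F i) * (\sum_(j <- r') G j) +
    (\sum_(i <- r) F i) * d (\sum_(j <- r') G j).
  move=> d0 dD H; have dS := big_morph d dD d0.
  rewrite mulr_suml !dS !mulr_suml -big_split; apply: eq_bigr => i _ /=.
  rewrite !mulr_sumr dS -big_split; exact: eq_bigr.
have zerol (R : pzRingType) (d : R -> R) u :
    d 0 = 0 -> d (0 * u) = d 0 * u + 0 * d u.
  by move=> d0; rewrite !mul0r d0 mul0r addr0.
have zeror (R : pzRingType) (d : R -> R) u :
    d 0 = 0 -> d (u * 0) = d u * 0 + u * d 0.
  by move=> d0; rewrite !mulr0 d0 mulr0 addr0.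
have F2 (a : 'F_2) : a = 0 \/ a = 1.
  by case: a => -[|[|]] // ?; [left|right]; apply: val_inj.
have U1 (s : {fmonom crossing q w}) : diff << s >> = diff_word s.
  by rewrite diffU scale1r.
have DU (a b : 'F_2) (s t : {fmonom crossing q w}) :
  diff (<< a *g s >> * << b *g t >>)
  = diff << a *g s >> * << b *g t >> + << a *g s >> * diff << b *g t >>.
  have [->|->] := F2 a; first by rewrite monalgU0; apply: zerol.
  have [->|->] := F2 b; first by rewrite monalgU0; apply: zeror.
  have -> : << s >> * << t >> = << mmul s t >> :> A.
    by rewrite malgM_def fgmulUU mulr1.
  by rewrite !U1 -!gen_word fmM; apply: word_cat.
rewrite [x]monalgE [y]monalgE; apply: sums => // s t.
exact: diffD.
Qed.

End Dga.

Section Augmentation.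
Variables (q w : nat).
Local Notation A := (dga q w).

Definition aug_word (X : {set crossing q w}) (s : {fmonom crossing q w}) : 'F_2 :=
  \prod_(c <- s) (c \in X)%:R.

Lemma aug_word_morphism (X : {set crossing q w}) : mmorphism (aug_word X).
Proof.
by split=> [s t|]; rewrite /aug_word ?fmM ?big_cat // fm1 big_nil.
Qed.

HB.instance Definition _ (X : {set crossing q w}) :=
  isMultiplicative.Build {fmonom crossing q w} 'F_2 (aug_word X)
    (aug_word_morphism X).

(* The algebra homomorphism extending the indicator function of X. *)
Definition aug_hom (X : {set crossing q w}) : {rmorphism A -> 'F_2} :=
  mmap idfun (aug_word X).

Lemma aug_gen (X : {set crossing q w}) (c : crossing q w) :
  aug_hom X (gen c) = (c \in X)%:R.
Proof. by rewrite /= mmapU /= mul1r /aug_word fmU big_seq1. Qed.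

Definition augmentation (beta : braid_word q w) (X : {set crossing q w}) : Prop :=
  (forall c, c \in X -> grading c = 0%N) /\
  (forall c, grading c = 1%N -> aug_hom X (diff beta (gen c)) = 0).

End Augmentation.

(* Main.v *)
Require Import Defs.
From mathcomp Require Import all_boot all_order all_algebra.
From mathcomp Require Import finmap monalg zify.

Set Implicit Arguments.
Unset Strict Implicit.
Unset Printing Implicit Defensive.

Import GRing.Theory.
Local Open Scope ring_scope.

(** Let F be the strand of the braid that starts at the top left endpoint and G
    the one that ends at the top right endpoint. If F <> G then at some crossing
    F passes from above to below G; make it a switch, so that the eye of the top
    endpoint follows F up to this crossing and G afterwards. Deleting this path
    leaves a braid with one strand less (the other halves of G and F being
    joined), whose crossings are treated recursively; if F = G the strand is
    deleted without a switch. This is a ruling because the deleted path is the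
    upper arc at its only switch. It is an augmentation because over Z_2 the
    condition [C_(n,n) = 1] for all [n] says that Gaussian elimination without
    row exchanges finds all pivots equal to [1] in the path matrix: the first
    pivot counts the paths from top to top, of which the deleted path is the
    only one, and the first Schur complement is the path matrix of the smaller
    braid, since [B_(i,0) * B_(0,j)] counts the paths that run along the lower
    arc at the switch. *)

(** * Gaussian elimination and admissible sequences *)

(** Entry [(i, j)] after [n] elimination steps with pivots equal to 1; over Z_2, adding is the same
    as subtracting. *)
Fixpoint elim_entry (R : pzSemiRingType) (M : nat -> nat -> R) (n i j : nat) : R :=
  if n is n'.+1 then
    elim_entry M n' i j + elim_entry M n' i n' * elim_entry M n' n' j
  else M i j.

(** The recursion peels off the last elimination step; splitting off the first one instead matches
    an induction that deletes the top path. *)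
Lemma elim_entry_schur (R : pzSemiRingType) (M M' : nat -> nat -> R) (n i j : nat) :
  (forall i j, M i.+1 j.+1 + M i.+1 0%N * M 0%N j.+1 = M' i j) ->
  elim_entry M n.+1 i.+1 j.+1 = elim_entry M' n i j.
Proof.
move=> MM'; elim: n i j => [|n IHn] i j; first by rewrite /= MM'.
by rewrite -/(elim_entry M' n.+1 i j) [RHS]/= -!IHn.
Qed.

Fixpoint chain_nat (R : pzSemiRingType) (M : nat -> nat -> R) (q : nat) (i : nat)
    (s : seq 'I_q) (j : nat) : R :=
  if s is l :: s' then M i l * chain_nat M l s' j else M i j.

Lemma chain_nat_cat (R : pzSemiRingType) (M : nat -> nat -> R) (q i j : nat)
    (s1 s2 : seq 'I_q) (x : 'I_q) :
  chain_nat M i (s1 ++ x :: s2) j = chain_nat M i s1 x * chain_nat M x s2 j.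
Proof. by elim: s1 i => [|y s1 IHs] i //=; rewrite IHs mulrA. Qed.

(** Equal letters on the same side are separated there, those on different sides by [x]. *)
Lemma admissible_join (q : nat) (x : 'I_q) (s1 s2 : seq 'I_q) :
  admissible s1 -> all (fun i : 'I_q => (i < x)%N) s1 ->
  admissible s2 -> all (fun i : 'I_q => (i < x)%N) s2 ->
  admissible (s1 ++ x :: s2).
Proof.
move=> A1 /allP l1 A2 /allP l2; apply/admissibleP => x0 u v.
rewrite size_cat /= => /andP[uv vs].
have n1 a : (a < size s1)%N -> nth x0 (s1 ++ x :: s2) a = nth x0 s1 a.
  by move=> ha; rewrite nth_cat ha.
have n0 : nth x0 (s1 ++ x :: s2) (size s1) = x by rewrite nth_cat ltnn subnn.
have n2 a : nth x0 (s1 ++ x :: s2) (size s1 + a.+1) = nth x0 s2 a.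
  by rewrite nth_cat ltnNge leq_addr /= addKn.
have L1 a : (a < size s1)%N -> (nth x0 s1 a < x)%N by move=> /(mem_nth x0)/l1.
have L2 a : (a < size s2)%N -> (nth x0 s2 a < x)%N by move=> /(mem_nth x0)/l2.
have [us|us|us] := ltngtP u (size s1).
- have [vs1|vs1|->] := ltngtP v (size s1).
  + rewrite !n1 // => e.
    have [|t t_uv lt] := admissibleP _ A1 x0 u v _ e; first by rewrite uv.
    by exists t; rewrite // n1 //; lia.
  + move=> _; exists (size s1); first by rewrite us.
    by rewrite n0 n1 // L1.
  + by rewrite n0 n1 // => e; have := L1 _ us; rewrite e ltnn.
- have [u' eu] : exists u', u = (size s1 + u'.+1)%N by exists (u - size s1).-1; lia.
  have [v' ev] : exists v', v = (size s1 + v'.+1)%N by exists (v - size s1).-1; lia.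
  subst u v; rewrite !n2 => e.
  have [|t t_uv lt] := admissibleP _ A2 x0 u' v' _ e; first by lia.
  by exists (size s1 + t.+1)%N; rewrite ?n2 //; lia.
- have [v' ev] : exists v', v = (size s1 + v'.+1)%N by exists (v - size s1).-1; lia.
  subst u v; rewrite n2 n0 => e.
  have := L2 v'; rewrite -e ltnn => /(_ _)/negP[]; lia.
Qed.

Lemma admissible_split_top (q : nat) (x : 'I_q) (s1 s2 : seq 'I_q) :
  admissible (s1 ++ x :: s2) ->
  all (fun i : 'I_q => (i < x.+1)%N) (s1 ++ x :: s2) ->
  [/\ admissible s1, all (fun i : 'I_q => (i < x)%N) s1,
      admissible s2 & all (fun i : 'I_q => (i < x)%N) s2].
Proof.
move=> A /allP le.
have lt (i : 'I_q) : i != x -> i \in s1 ++ x :: s2 -> (i < x)%N.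
  by move=> ix /le; rewrite ltnS leq_eqVlt val_eqE (negPf ix).
have once u v : (u < v < size (s1 ++ x :: s2))%N ->
    nth x (s1 ++ x :: s2) u = x -> nth x (s1 ++ x :: s2) v = x -> false.
  move=> uvs eu ev; have [|t tuv] := admissibleP _ A x u v uvs.
    by rewrite eu ev.
  have /andP[_ tv] := tuv; have /andP[_ vs] := uvs.
  by rewrite eu ltnNge -ltnS le // mem_nth // (ltn_trans tv).
have sz : size (s1 ++ x :: s2) = (size s1 + (size s2).+1)%N by rewrite size_cat.
split.
- exact: (@admissible_cat q [::] s1 (x :: s2)).
- apply/allP => i is1; apply: lt; last by rewrite mem_cat is1.
  apply/eqP => e; subst i.
  have lt1 : (seq.index x s1 < size s1)%N by rewrite index_mem.
  apply: notF (once (seq.index x s1) (size s1) _ _ _).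
  + by rewrite sz; lia.
  + by rewrite nth_cat lt1 nth_index.
  + by rewrite nth_cat ltnn subnn.
- by apply: (@admissible_cat q (rcons s1 x) s2 [::]); rewrite cats0 cat_rcons.
- apply/allP => i is2; apply: lt; last by rewrite mem_cat inE is2 !orbT.
  apply/eqP => e; subst i.
  have lt2 : (seq.index x s2 < size s2)%N by rewrite index_mem.
  apply: notF (once (size s1) (size s1 + (seq.index x s2).+1)%N _ _ _).
  + by rewrite sz; lia.
  + by rewrite nth_cat ltnn subnn.
  + by rewrite nth_cat ltnNge leq_addr /= addKn /= nth_index.
Qed.

(* The largest letter of an admissible sequence occurs only once; hence C_(n,n)  *)
(* satisfies the recursion of Gaussian elimination.                            *)
Lemma perm_D (q : nat) (x : 'I_q) :
  perm_eq (D q x.+1) (D q x ++ [seq s1 ++ x :: s2 | s1 <- D q x, s2 <- D q x]).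
Proof.
have notin (s : seq 'I_q) : s \in D q x -> x \notin s.
  by rewrite mem_D => /andP[_ /allP l]; apply/negP => /l; rewrite ltnn.
apply: uniq_perm; first exact: uniq_D.
  rewrite cat_uniq uniq_D /=; apply/andP; split.
    apply/hasPn => _ /allpairsP[[s1 s2] /= [_ _ ->]].
    by apply/negP => /notin; rewrite mem_cat inE eqxx orbT.
  apply: allpairs_uniq; rewrite ?uniq_D // => -[s1 s2] [t1 t2].
  move=> /= /allpairsP[[a1 a2] /= [d1 _ [-> _]]].
  move=> /allpairsP[[c1 c2] /= [e1 _ [-> _]]] e.
  have sz : size a1 = size c1.
    have := congr1 (seq.index x) e.
    by rewrite !index_cat /= eqxx (negPf (notin _ d1)) (negPf (notin _ e1)) !addn0.
  by move/eqP: e; rewrite eqseq_cat // eqseq_cons eqxx => /andP[/eqP-> /eqP->].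
move=> s; rewrite mem_cat; apply/idP/orP => [|[|]].
- rewrite mem_D => /andP[A l]; have [xs|xs] := boolP (x \in s); last first.
    left; rewrite mem_D A; apply/allP => i is_.
    have := allP l _ is_; rewrite ltnS leq_eqVlt val_eqE => /orP[/eqP e|//].
    by rewrite -e is_ in xs.
  right; case/splitPr: xs A l => s1 s2 A l.
  have [A1 l1 A2 l2] := admissible_split_top A l.
  by apply/allpairsP; exists (s1, s2); rewrite !mem_D A1 l1 A2 l2.
- rewrite !mem_D => /andP[-> /= l]; apply: sub_all l => i; exact: leqW.
- move=> /allpairsP[[s1 s2] /=]; rewrite !mem_D => -[/andP[A1 l1] /andP[A2 l2] ->].
  rewrite admissible_join //= all_cat /= ltnSn.
  by apply/andP; split; [move: l1|move: l2]; apply: sub_all => i; exact: leqW.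
Qed.

(** Cutting a sequence at its largest letter factors its [chain_nat], so the sum over pairs becomes
    the product in [elim_entry]. *)
Lemma sum_D_elim (R : pzSemiRingType) (M : nat -> nat -> R) (q n i j : nat) :
  (n <= q)%N -> \sum_(s <- D q n) chain_nat M i s j = elim_entry M n i j.
Proof.
elim: n i j => [|n IHn] i j nq.
  suff -> : D q 0 = [:: [::]] by rewrite big_seq1.
  apply: perm_small_eq => //; apply: uniq_perm; rewrite ?uniq_D // => s.
  rewrite mem_D inE; case: s => [|x s]; rewrite ?andbF //= andbT eqxx.
  by apply/admissibleP => x0 u v; rewrite ltn0 andbF.
have eD : perm_eq (D q n.+1)
    (D q n ++ [seq s1 ++ Ordinal nq :: s2 | s1 <- D q n, s2 <- D q n]).
  exact: perm_D.
rewrite (perm_big _ eD) big_cat IHn ?(ltnW nq) // [RHS]/=.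
congr (_ + _); rewrite big_allpairs_dep -!IHn ?(ltnW nq) // big_distrlr.
by apply: eq_bigr => s1 _; apply: eq_bigr => s2 _; rewrite chain_nat_cat.
Qed.

(** * Path counts and rulings of words with marked switches *)

Definition swapn (k i : nat) : nat :=
  if i == k then k.+1 else if i == k.+1 then k else i.

Ltac nat_cases :=
  rewrite /swapn /bump /unbump;
  repeat match goal with
  | |- context [if ?b then _ else _] =>
      lazymatch b with
      | context [if _ then _ else _] => fail
      | _ => let H := fresh in destruct b eqn:H
      end
  end; lia.

Lemma swapnK k : involutive (swapn k).
Proof. by move=> i; nat_cases. Qed.

(* A word is decorated with booleans marking its switches, i.e. the crossings   *)
(* at which paths may turn; [paths W v i] is entry [i] of the path matrix of   *)
(* [W] applied to the column vector [v].                                       *)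
Fixpoint paths (R : pzSemiRingType) (W : seq (nat * bool)) (v : nat -> R) (i : nat) : R :=
  if W is (k, b) :: W' then
    (if (i == k) && b then paths W' v k else 0) + paths W' v (swapn k i)
  else v i.

Lemma paths_cat (R : pzSemiRingType) W1 W2 (v : nat -> R) :
  paths (W1 ++ W2) v =1 paths W1 (paths W2 v).
Proof. by elim: W1 => [|[k b] W1 IHW] i //=; rewrite !IHW. Qed.

Lemma eq_paths (R : pzSemiRingType) W (u v : nat -> R) :
  u =1 v -> paths W u =1 paths W v.
Proof. by move=> uv; elim: W => [|[k b] W IHW] i //=; rewrite !IHW. Qed.

(** This absorbs the rank-one term of a Schur complement into the vector at which paths end. *)
Lemma paths_linear (R : pzSemiRingType) W (u v : nat -> R) (c : R) (i : nat) :
  paths W (fun j => u j + v j * c) i = paths W u i + paths W v i * c.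
Proof.
elim: W i => [|[k b] W IHW] i //=; rewrite !IHW mulrDl addrACA; congr (_ + _).
by case: ifP; rewrite ?mul0r ?addr0.
Qed.

Lemma paths0 (R : pzSemiRingType) W (i : nat) : paths W (fun=> 0 : R) i = 0.
Proof. by elim: W i => [|[k b] W IHW] i //=; rewrite !IHW addr0 if_same. Qed.

(* [s] and [t] give, for each level of the left and right slices, the label of *)
(* the path found there.                                                       *)
Fixpoint ruled (W : seq (nat * bool)) (s t : nat -> nat) : Prop :=
  match W with
  | [::] => s =1 t
  | (k, true) :: W' => (s k < s k.+1)%N /\ ruled W' s t
  | (k, false) :: W' => ruled W' (s \o swapn k) t
  end.

Lemma ruled_cat W1 W2 s t :
  (exists2 r, ruled W1 s r & ruled W2 r t) <-> ruled (W1 ++ W2) s t.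
Proof.
have ext W u v x : u =1 v -> ruled W v x -> ruled W u x.
  elim: W u v => [|[k []] W IHW] u v /= uv; first exact: ftrans.
    by rewrite !uv => -[-> /(IHW _ _ uv)].
  by apply: IHW => i /=; rewrite uv.
elim: W1 s => [|[k []] W1 IHW] s /=; last exact: IHW.
  by split=> [[r sr]|]; [exact: ext|exists s].
rewrite -IHW; split=> [[r [? ?] ?]|[? [r ? ?]]]; last by exists r.
by split=> //; exists r.
Qed.

(** * Deletion of a strand that meets no switch *)

(* [del_strand p W p' W']: the strand of [W] from level [p] to level [p'] meets *)
(* no switch, and deleting it leaves [W'].                                     *)
Inductive del_strand : nat -> seq (nat * bool) -> nat -> seq (nat * bool) -> Prop :=
| del_nil p : del_strand p [::] p [::]
| del_cross p k W p' W' : (p == k) || (p == k.+1) ->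
    del_strand (swapn k p) W p' W' -> del_strand p ((k, false) :: W) p' W'
| del_skip p k b W p' W' : p != k -> p != k.+1 ->
    del_strand p W p' W' ->
    del_strand p ((k, b) :: W) p' ((unbump p k, b) :: W').

Lemma swapn_bump_cross p k i : (p == k) || (p == k.+1) ->
  swapn k (bump p i) = bump (swapn k p) i.
Proof. by nat_cases. Qed.

Lemma swapn_bump_skip p k i : p != k -> p != k.+1 ->
  swapn k (bump p i) = bump p (swapn (unbump p k) i).
Proof. by nat_cases. Qed.

(** No path can turn off or onto a strand without switches. *)
Lemma paths_del (R : pzSemiRingType) p W p' W' (v : nat -> R) :
  del_strand p W p' W' ->
  paths W v p = v p' /\ forall i, paths W v (bump p i) = paths W' (v \o bump p') i.
Proof.
elim=> {p W p' W'} [p //|p k W p' W' pk _ [IH0 IH]|p k b W p' W' pk pk1 _ [IH0 IH]] /=.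
  split=> [|i]; first by rewrite andbF add0r.
  by rewrite andbF add0r swapn_bump_cross.
split=> [|i]; first by rewrite (negPf pk) add0r /swapn (negPf pk) (negPf pk1).
have -> : (bump p i == k) = (i == unbump p k) by nat_cases.
have ku : bump p (unbump p k) = k by apply: unbumpK; rewrite inE eq_sym.
by rewrite swapn_bump_skip // IH -{2}ku IH.
Qed.

(** The deleted path gets label 0 and all other labels rise by one, which preserves the comparisons
    at the remaining switches. *)
Lemma ruled_del p W p' W' s s' t t' :
  del_strand p W p' W' ->
  s p = 0%N -> (forall i, s (bump p i) = (s' i).+1) ->
  t p' = 0%N -> (forall i, t (bump p' i) = (t' i).+1) ->
  ruled W' s' t' -> ruled W s t.
Proof.
move=> del; elim: del s s' => {p W p' W'}
  [p|p k W p' W' pk _ IH|p k b W p' W' pk pk1 _ IH] s s' s0 sS t0 tS /=.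
- move=> st i; have [->|ip] := eqVneq i p; first by rewrite s0 t0.
  by rewrite -(@unbumpK p i) ?inE // sS tS st.
- apply: IH => //= [|i]; last by rewrite -sS -swapn_bump_cross //; congr s; nat_cases.
  by rewrite -s0; congr s; move: pk; nat_cases.
case: b => [[lt]|] /=.
  split; last exact: IH sS t0 tS b.
  by move: lt; rewrite -ltnS -!sS; congr (s _ < s _)%N; nat_cases.
apply: IH => //= [|i]; first by rewrite /swapn (negPf pk) (negPf pk1).
by rewrite swapn_bump_skip // sS.
Qed.

(** * Choice of the switch and induction on the number of strands *)

Definition follow (w : seq nat) (p : nat) : nat := foldl (fun p k => swapn k p) p w.

Lemma follow_surj w p : exists g, follow w g = p.
Proof.
elim: w => [|k w [g <-]] /=; first by exists p.
by exists (swapn k g); rewrite /= swapnK.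
Qed.

(** The strand from [g] ends at the top, so it must overtake the one from [p]; their order changes
    only where they cross, and the first such crossing is taken. *)
Lemma crossing_split w p g : (p < g)%N -> follow w g = 0%N ->
  exists w1 k w2, [/\ w = w1 ++ k :: w2, follow w1 p = k & follow w2 k = 0%N].
Proof.
elim: w p g => [|k w IHw] p g pg /=; first by move=> g0; rewrite g0 in pg.
have [lt|ge] := ltnP (swapn k p) (swapn k g).
  move=> /(IHw _ _ lt)[w1 [k' [w2 [-> e1 e2]]]].
  by exists (k :: w1), k', w2.
have [-> ->] : p = k /\ g = k.+1 by move: ge; nat_cases.
rewrite {1}/swapn -[k.+1 == k]negbK neq_ltn ltnSn orbT /= eqxx => e.
by exists [::], k, w.
Qed.

(** The smaller word is fixed before its switches are known: any later marking [W'] of it lifts to a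
    marking of [w]. *)
Lemma del_exists q w p : all (fun k => k.+1 < q.+1)%N w -> (p < q.+1)%N ->
  exists2 w', all (fun k => k.+1 < q)%N w' &
  forall W', map fst W' = w' ->
  exists2 W, map fst W = w & del_strand p W (follow w p) W'.
Proof.
elim: w p => [|k w IHw] p /=.
  by move=> _ _; exists [::] => // -[|//] _; exists [::] => //; constructor.
move=> /andP[kq wq] pq.
have [||w' w'q ex] := IHw (swapn k p) => //; first by nat_cases.
have [pk|] := boolP ((p == k) || (p == k.+1)).
  exists w' => // W' /ex[W Ww del]; exists ((k, false) :: W); first by rewrite /= Ww.
  exact: del_cross.
rewrite negb_or => /andP[pk pk1].
have e : swapn k p = p by rewrite /swapn (negPf pk) (negPf pk1).
rewrite e in ex *; exists (unbump p k :: w').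
  by rewrite /= w'q andbT; nat_cases.
case=> [//|[_ b] W'] [-> /ex[W Ww del]].
by exists ((k, b) :: W); [rewrite /= Ww|exact: del_skip].
Qed.

Definition path_entry (R : pzSemiRingType) W (i j : nat) : R :=
  paths W (fun l => (l == j)%:R) i.

Lemma path_entry_del (R : pzSemiRingType) W W' :
  del_strand 0 W 0 W' ->
  path_entry R W 0 0 = 1 /\ forall i j,
  path_entry R W i.+1 j.+1 + path_entry R W i.+1 0 * path_entry R W 0 j.+1 =
  path_entry R W' i j.
Proof.
move=> del; split=> [|i j]; first by rewrite /path_entry (paths_del _ del).1.
rewrite /path_entry (paths_del _ del).1 /= mulr0 addr0.
by rewrite ((paths_del _ del).2 i) /=; apply: eq_paths.
Qed.

Lemma path_entry_switch (R : pzSemiRingType) k W1 W2 W1' W2' :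
  del_strand 0 W1 k W1' -> del_strand k W2 0 W2' ->
  let W := W1 ++ (k, true) :: W2 in
  path_entry R W 0 0 = 1 /\ forall i j,
  path_entry R W i.+1 j.+1 + path_entry R W i.+1 0 * path_entry R W 0 j.+1 =
  path_entry R (W1' ++ W2') i j.
Proof.
move=> del1 del2 W.
(* A path from the top endpoint either turns at the switch and ends at 0, or goes straight on to
   level [k.+1], just below the deleted path. *)
have W0 (v : nat -> R) : paths W v 0 = v 0%N + paths W2' (v \o succn) k.
  rewrite paths_cat (paths_del _ del1).1 /= eqxx {1}/swapn eqxx.
  rewrite (paths_del _ del2).1; congr (_ + _).
  by have <- : bump k k = k.+1 by [nat_cases]; rewrite (paths_del _ del2).2.
(* Any other path reaching the switch comes from level [k.+1], numbered [k] in [W1'], and goes up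
   onto the strand ending at 0. *)
have WS (v : nat -> R) i : paths W v i.+1 =
    paths W1' (fun l => if l == k then v 0%N else paths W2' (v \o succn) l) i.
  rewrite paths_cat ((paths_del _ del1).2 i); apply: eq_paths => l /=.
  have -> : (bump k l == k) = false by nat_cases.
  rewrite add0r; case: eqVneq => [->|lk].
    have -> : swapn k (bump k k) = k by nat_cases.
    by rewrite (paths_del _ del2).1.
  have -> : swapn k (bump k l) = bump k l by nat_cases.
  by rewrite (paths_del _ del2).2.
rewrite /path_entry; split=> [|i j].
  by rewrite W0 /= (eq_paths _ (v := fun=> 0)) // paths0 addr0.
(* At [l = k] the product term supplies the value of [paths W2'] at [k]: the continuation along the
   lower arc. *)
rewrite W0 !WS /= add0r -paths_linear paths_cat; apply: eq_paths => l /=.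
have -> : paths W2' ((fun m : nat => (m == 0)%:R : R) \o succn) l = 0.
  by rewrite (eq_paths _ (v := fun=> 0)) // paths0.
by case: eqP => [->|_]; rewrite ?mul1r ?add0r ?mul0r ?addr0.
Qed.

Lemma ruled_switch k W1 W2 W1' W2' :
  del_strand 0 W1 k W1' -> del_strand k W2 0 W2' ->
  ruled (W1' ++ W2') id id -> ruled (W1 ++ (k, true) :: W2) id id.
Proof.
move=> del1 del2 /ruled_cat[r' r1 r2]; apply/ruled_cat.
(* Labels in the slice at the switch: the top path has label 0 at level [k], hence the smaller label
   there. *)
pose r l := if l == k then 0%N else (r' (unbump k l)).+1.
have r0 : r k = 0%N by rewrite /r eqxx.
have rS i : r (bump k i) = (r' i).+1.
  by rewrite /r bumpK; case: ifP => //; nat_cases.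
exists r; first exact: (ruled_del del1 _ _ r0 rS r1).
split; last exact: (ruled_del del2 r0 rS _ _ r2).
have -> : k.+1 = bump k k by nat_cases.
by rewrite r0 rS.
Qed.

Lemma ruled_elim_exists (R : pzSemiRingType) q w :
  all (fun k => k.+1 < q)%N w ->
  exists W, [/\ map fst W = w, ruled W id id &
    forall n, (n < q)%N -> elim_entry (path_entry R W) n n n = 1].
Proof.
elim: q w => [|q IHq] w.
  case: w => [|//] _; exists [::]; split=> //.
move=> wq.
have schur W W' : map fst W = w -> ruled W id id ->
    (path_entry R W 0 0 = 1 /\ forall i j,
     path_entry R W i.+1 j.+1 + path_entry R W i.+1 0 * path_entry R W 0 j.+1 =
     path_entry R W' i j) ->
    (forall n, (n < q)%N -> elim_entry (path_entry R W') n n n = 1) ->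
    exists W, [/\ map fst W = w, ruled W id id &
      forall n, (n < q.+1)%N -> elim_entry (path_entry R W) n n n = 1].
  move=> Ww rW [W0 WS] E; exists W; split=> // -[|n] nq //.
  by rewrite (elim_entry_schur _ _ _ WS) E.
(* The strand from [g] ends at the top; [g = 0] is the case without a switch. *)
have [g g0] := follow_surj w 0.
have [g_gt0|] := ltnP 0 g; last first.
  rewrite leqn0 => /eqP e; subst g.
  have [w' w'q ex] := del_exists wq (ltn0Sn q).
  have [W' [/ex[W Ww del] rW' E]] := IHq w' w'q.
  rewrite g0 in del; apply: (schur W W') => //.
    exact: (ruled_del del _ _ _ _ rW').
  exact: path_entry_del.
have [w1 [k [w2 [e f1 f2]]]] := crossing_split g_gt0 g0.
subst w; move: wq; rewrite all_cat /= => /and3P[w1q kq w2q].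
have [w1' w1'q ex1] := del_exists w1q (ltn0Sn q).
have [w2' w2'q ex2] := del_exists w2q (ltnW kq).
have [|W' [W'w rW' E]] := IHq (w1' ++ w2'); first by rewrite all_cat w1'q.
have W'E : W' = take (size w1') W' ++ drop (size w1') W' by rewrite cat_take_drop.
have [|W1 W1w del1] := ex1 (take (size w1') W').
  by rewrite map_take W'w take_size_cat.
have [|W2 W2w del2] := ex2 (drop (size w1') W').
  by rewrite map_drop W'w drop_size_cat.
rewrite f1 in del1; rewrite f2 in del2; rewrite W'E in rW' E.
apply: (schur (W1 ++ (k, true) :: W2) _ _ _ _ E).
- by rewrite map_cat /= W1w W2w.
- exact: ruled_switch rW'.
- exact: path_entry_switch.
Qed.

(** * From marked words to sets of crossings and the path matrix *)

Definition decorated (q w : nat) (beta : braid_word q w) (X : {set 'I_w}) rs :=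
  [seq (nat_of_ord (tnth beta r), r \in X) | r <- rs].

Lemma decorated_exists (q w : nat) (beta : braid_word q w) W :
  map fst W = map (@nat_of_ord _) beta ->
  exists X, decorated beta X (enum 'I_w) = W.
Proof.
move=> Wb; have sW : size W = w by rewrite -(size_map fst) Wb size_map size_tuple.
exists [set r : 'I_w | nth false (map snd W) r].
apply: (@eq_from_nth _ (0%N, false)); rewrite size_map size_enum_ord ?sW // => i iw.
rewrite (nth_map (Ordinal iw)) ?size_enum_ord // inE.
have -> : nth (Ordinal iw) (enum 'I_w) i = Ordinal iw by apply: val_inj; rewrite /= nth_enum_ord.
have e1 : nat_of_ord (tnth beta (Ordinal iw)) = (nth (0%N, false) W i).1.
  have b0 := tnth beta (Ordinal iw).
  rewrite -(nth_map _ 0%N) ?sW // Wb (nth_map b0) ?size_tuple //.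
  by rewrite (tnth_nth b0).
by rewrite e1 /= (nth_map (0%N, false)) ?sW // -surjective_pairing.
Qed.

(** Row [i] of [Bsigma] has 1 in column [swapn k i] and, if [i = k], the crossing in column [k]: the
    two terms of [paths]. *)
Lemma path_matrix_aug (q w : nat) (beta : braid_word q w) (X : {set 'I_w}) (i j : 'I_q) :
  aug_hom [set inl r | r in X] (path_matrix beta i j) =
  path_entry 'F_2 (decorated beta X (enum 'I_w)) i j.
Proof.
have -> : path_matrix beta = \big[mulmx/1%:M]_(r <- enum 'I_w)
    Bsigma (tnth beta r) (gen (inl r)) by rewrite enumT /path_matrix [index_enum _]unlock.
elim: (enum 'I_w) i => [|r rs IHrs] i; first by rewrite big_nil mxE rmorph_nat.
rewrite big_cons mxE rmorph_sum.
set k := tnth beta r; have kq : (k.+1 < q)%N by have := ltn_ord k; lia.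
have iq : (swapn k i < q)%N by have := ltn_ord i; nat_cases.
have sumE a (f : nat -> 'F_2) : (a < q)%N ->
    \sum_(l < q) (l == a :> nat)%:R * f l = f a.
  move=> aq; rewrite (bigD1 (Ordinal aq)) //= eqxx mul1r big1 ?addr0 // => l.
  by rewrite -val_eqE => /negPf/= ->; rewrite mul0r.
pose eps : {rmorphism dga q w -> 'F_2} := aug_hom [set inl r | r in X].
have epsE (a b c d : bool) :
    eps (if a then 1 else if b then 1 else if c then 0 else d%:R) =
    (if a then true else if b then true else if c then false else d)%:R.
  by case: a b c d => [] [] [] []; rewrite ?rmorph0 ?rmorph1.
have entryE l : eps (Bsigma k (gen (inl r)) i l) =
    ((i == k :> nat) && (r \in X))%:R * (l == k :> nat)%:R +
    (l == swapn k i :> nat)%:R.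
  rewrite mxE -natrM -natrD.
  have rX : (inl r \in [set @inl _ 'I_q r | r in X]) = (r \in X).
    by apply/imsetP/idP => [[r' ? [->]]|]; last by exists r.
  case: ifP => [/andP[/eqP-> /eqP->]|ikl].
    by rewrite /eps aug_gen rX eqxx /swapn eqxx muln1 ltn_eqF // addn0.
  rewrite epsE -val_eqE mulnb andbAC ikl add0n; congr (nat_of_bool _)%:R.
  by rewrite /=; apply/idP/eqP; nat_cases.
pose f l := path_entry 'F_2 (decorated beta X rs) l j.
pose c : 'F_2 := ((i == k :> nat) && (r \in X))%:R.
transitivity (\sum_(l < q)
    ((l == k :> nat)%:R * (c * f l) + (l == swapn k i :> nat)%:R * f l)).
  apply: eq_bigr => l _; rewrite -/eps rmorphM entryE.
  by rewrite [X in _ * X]IHrs mulrDl mulrCA mulrA.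
rewrite big_split /= (sumE _ (fun l => c * f l)) ?(sumE _ f) //; last exact: ltnW.
by rewrite /c /path_entry /=; case: ifP => _; rewrite ?mul1r ?mul0r.
Qed.

(** * The ruling of the closed front *)

Lemma ruling_left_cusps (T : finType) (X : {set T}) m d (f : front T) :
  ruling_from X m (iota 0 m ++ rev (iota 0 m)) ([seq LeftCusp i | i <- iota m d] ++ f) =
  ruling_from X (m + d) (iota 0 (m + d) ++ rev (iota 0 (m + d))) f.
Proof.
elim: d m => [|d IHd] m /=; first by rewrite addn0.
rewrite addnS -addSn -IHd; congr ruling_from.
rewrite take_size_cat ?size_iota // drop_size_cat ?size_iota //.
by rewrite -[in RHS]addn1 iotaD rev_cat -catA.
Qed.

Lemma ruling_right_cusps (T : finType) (X : {set T}) n q :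
  ruling_from X n (iota 0 q ++ rev (iota 0 q)) [seq RightCusp i | i <- rev (iota 0 q)].
Proof.
elim: q => [//|q IHq].
rewrite -addn1 iotaD rev_cat /= -catA drop_size_cat ?size_iota //= eqxx.
by rewrite take_size_cat ?size_iota.
Qed.

Lemma iota_split q k : (k.+1 < q)%N ->
  iota 0 q = iota 0 k ++ [:: k, k.+1 & iota k.+2 (q - k.+2)].
Proof.
move=> kq; have -> : q = (k + (2 + (q - k.+2)))%N by lia.
by rewrite !iotaD /=; do ?congr (_ ++ _); do 2?congr cons; congr iota; lia.
Qed.

(* The closing strands are the upper q strands of the slice; since eyes are  *)
(* numbered from the outermost one, the strand ending at level i belongs to  *)
(* the eye q - 1 - i.                                                        *)
Definition braid_slice (q : nat) (s : nat -> nat) : seq nat :=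
  iota 0 q ++ [seq (q.-1 - s i)%N | i <- iota 0 q].

Lemma braid_slice_id q s : s =1 id -> braid_slice q s = iota 0 q ++ rev (iota 0 q).
Proof.
move=> s_id; congr (_ ++ _).
apply: (@eq_from_nth _ 0%N); rewrite size_map ?size_rev // size_iota => i iq.
rewrite (nth_map 0%N) ?size_iota // nth_rev ?size_iota // !nth_iota ?s_id; lia.
Qed.

Lemma braid_slice_split q k s : (k.+1 < q)%N ->
  braid_slice q s = (iota 0 q ++ [seq (q.-1 - s i)%N | i <- iota 0 k]) ++
    [:: (q.-1 - s k)%N, (q.-1 - s k.+1)%N & [seq (q.-1 - s i)%N | i <- iota k.+2 (q - k.+2)]].
Proof. by move=> kq; rewrite /braid_slice {2}(iota_split kq) map_cat catA. Qed.

(** The closing strands give [v], [u], the levels above [k] belong to other eyes by injectivity, and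
    then come [u], [v]: a nested pattern. *)
Lemma nested_not_interleaved q k s : injective s -> (k.+1 < q)%N ->
  (forall i, (i < q)%N -> (s i < q)%N) -> (s k < s k.+1)%N ->
  ~~ interleaved (braid_slice q s) (q.-1 - s k) (q.-1 - s k.+1).
Proof.
move=> inj_s kq sq lt; set u := (q.-1 - s k)%N; set v := (q.-1 - s k.+1)%N.
have vu : (v < u < q)%N by have := sq _ kq; rewrite /u /v; lia.
pose p z := (z == u) || (z == v).
have top : filter p (iota 0 q) = [:: v; u].
  apply: (irr_sorted_eq ltn_trans ltnn).
  - exact/(sorted_filter ltn_trans)/iota_ltn_sorted.
  - by rewrite /= andbT; case/andP: vu.
  - by move=> z; rewrite mem_filter mem_iota !inE /p; lia.
have pre : filter p [seq (q.-1 - s i)%N | i <- iota 0 k] = [::].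
  apply/eqP; rewrite -[_ == _]negbK -has_filter; apply/hasPn => _ /mapP[i + ->].
  rewrite mem_iota /= => ik.
  have [s1 s2] : s i <> s k /\ s i <> s k.+1 by split=> /inj_s; lia.
  have := sq i; have := sq k; have := sq _ kq; rewrite /p /u /v; lia.
rewrite /interleaved (braid_slice_split _ kq) !filter_cat top pre -/u -/v /=.
rewrite eqxx !inE !eqseq_cons; lia.
Qed.

(** Injectivity of [s] is carried along to keep the two eyes at each crossing distinct. *)
Lemma ruling_from_ruled (q w : nat) (beta : braid_word q w) (X : {set 'I_w}) rs s :
  injective s -> (forall i, (i < q)%N -> (s i < q)%N) ->
  ruled (decorated beta X rs) s id ->
  ruling_from X q (braid_slice q s)
    ([seq Crossing r (q + tnth beta r)%N | r <- rs]
     ++ [seq RightCusp i | i <- rev (iota 0 q)]).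
Proof.
elim: rs s => [|r rs IHrs] s inj_s sq.
  by move=> /braid_slice_id ->; exact: ruling_right_cusps.
rewrite [ruled _ _ _]/= [map _ _]/= [_ ++ _]/= [ruling_from _ _ _ _]/=.
have kq : ((tnth beta r).+1 < q)%N by have := ltn_ord (tnth beta r); lia.
move: (nat_of_ord _) kq => k kq ok.
have sk : s k <> s k.+1 by move=> /inj_s; lia.
have uv : (q.-1 - s k)%N != (q.-1 - s k.+1)%N.
  by have := sq k; have := sq _ kq; lia.
have size_pre : size (iota 0 q ++ [seq (q.-1 - s i)%N | i <- iota 0 k]) = (q + k)%N.
  by rewrite size_cat size_map !size_iota.
have dE : drop (q + k) (braid_slice q s) = [:: (q.-1 - s k)%N, (q.-1 - s k.+1)%N
    & [seq (q.-1 - s i)%N | i <- iota k.+2 (q - k.+2)]].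
  by rewrite (braid_slice_split _ kq) drop_size_cat.
have tE : take (q + k) (braid_slice q s) =
    iota 0 q ++ [seq (q.-1 - s i)%N | i <- iota 0 k].
  by rewrite (braid_slice_split _ kq) take_size_cat.
rewrite dE tE uv /=.
case: ifP ok => [_ [lt ok]|_ ok].
  by rewrite nested_not_interleaved //= IHrs.
have -> : (iota 0 q ++ [seq (q.-1 - s i)%N | i <- iota 0 k]) ++
    [:: (q.-1 - s k.+1)%N, (q.-1 - s k)%N
      & [seq (q.-1 - s i)%N | i <- iota k.+2 (q - k.+2)]] =
    braid_slice q (s \o swapn k).
  have fix_s i : i != k -> i != k.+1 -> s (swapn k i) = s i.
    by rewrite /swapn => /negPf-> /negPf->.
  have [e1 e2] : swapn k k = k.+1 /\ swapn k k.+1 = k by split; nat_cases.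
  rewrite (braid_slice_split _ kq) /= e1 e2.
  congr ((_ ++ _) ++ [:: _, _ & _]); apply/eq_in_map => i;
    by rewrite mem_iota /= => ik; rewrite fix_s //; lia.
apply: IHrs => //; first exact: inj_comp (inv_inj (@swapnK k)).
by move=> i iq; apply: sq; nat_cases.
Qed.

Theorem theorem6p3 (q w : nat) (hq : (0 < q)%N) (beta : braid_word q w) :
  exists X : {set 'I_w},
    ruling_switches (front_closure beta) X /\
    augmentation beta [set inl r | r in X].
Proof.
have levels : all (fun k => k.+1 < q)%N (map (@nat_of_ord _) beta).
  by apply/allP => _ /mapP[i _ ->]; have := ltn_ord i; lia.
have [W [Wb rW elimW]] := ruled_elim_exists 'F_2 levels.
have [X XW] := decorated_exists Wb; exists X; split; last first.
  split=> [c /imsetP[r _ ->] //|[//|n] _].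
  rewrite diff_genE /= rmorphD rmorph1 /C rmorph_sum.
  pose M := path_entry 'F_2 W.
  have chainE (i : 'I_q) s : aug_hom [set inl r | r in X]
      (chain (path_matrix beta) i s n) = chain_nat M i s n.
    elim: s i => [|l s IHs] i; rewrite [chain _ _ _ _]/= ?rmorphM ?IHs;
      by rewrite path_matrix_aug XW.
  rewrite (eq_bigr _ (fun s _ => chainE n s)) sum_D_elim; last exact: ltnW.
  (* Each [C n] is sent to 1, and 1 + 1 = 0 in ['F_2]. *)
  by rewrite elimW //; apply: val_inj.
rewrite /ruling_switches /front_closure ruling_left_cusps add0n.
have -> : iota 0 q ++ rev (iota 0 q) = braid_slice q id.
  exact/esym/braid_slice_id.
by apply: ruling_from_ruled => //; rewrite XW.
Qed.
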